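(* Let $X$ be a complex Banach space, let $0\ne\omega\in\mathbb R$, $2<r\in\mathbb R$, and let $A$ be a set of functions with $C_0(J,X)\subset A\subset UC(J,X)$ (for instance $A=UC(J,X)$). Then $$g_{\omega,r}A\subset M(C_0(J,X))\subset M(g_{\omega,r}A).$$
   Context: $X\ne\{0\}$; $J$ is $[\alpha,\infty)$, $(\alpha,\infty)$ ($\alpha\in\mathbb R$) or $\mathbb R$. $g_{\omega,r}(t)=e^{i\omega|t|^r}$. $UC(J,X)$: uniformly continuous functions $J\to X$; $C_0(J,X)$: uniformly continuous functions vanishing at infinity (as $t\to\infty$, and also as $t\to-\infty$ if $J=\mathbb R$). $L^1_{\rm loc}(J,X)$: all functions $J\to X$ (not equivalence classes) Bochner–Lebesgue integrable over every compact interval contained in $J$. $(M_hf)(t)=\frac1h\int_0^hf(t+s)\,ds$ for $h>0$; $MB=\{f\in L^1_{\rm loc}(J,X):M_hf\in B\text{ for all }h>0\}$ for $B\subset X^J$. $\gamma A=\{\gamma f:f\in A\}$. *)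

(* Defs.v *)
From HB Require Import structures.
From mathcomp Require Import all_boot all_order all_algebra.
From mathcomp Require Import all_classical all_reals all_analysis.
From mathcomp Require Import complex.

Set Implicit Arguments.
Unset Strict Implicit.
Unset Printing Implicit Defensive.

Import Order.TTheory GRing.Theory Num.Theory.
Import numFieldNormedType.Exports.

Local Open Scope classical_set_scope.
Local Open Scope ring_scope.
Local Open Scope complex_scope.

(* Bochner-Lebesgue integral of functions R -> X on a compact interval.       *)
(* The sigma-algebra on R is the Borel one. Since approximation is only       *)
(* required almost everywhere, where "ae" means outside a subset of a Borel   *)
(* null set, this still captures all Lebesgue-measurable integrands; and      *)
(* \int of a nonnegative function, a supremum over simple functions below it, *)
(* is the usual integral for Lebesgue-measurable integrands as well.          *)
Section bochner.
Context {R : realType} {X : completeNormedModType R[i]}.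
Implicit Types (a b : R) (f : R -> X).

Definition simple_fun (s : R -> X) :=
  finite_set (range s) /\ forall x : X, measurable (s @^-1` [set x]).

Definition simple_integral a b (s : R -> X) : X :=
  \sum_(x \in range s)
    (fine (lebesgue_measure (`[a, b] `&` s @^-1` [set x])))%:C *: x.

(* Norms in X are elements of R[i] with zero imaginary part, hence Re.        *)
Definition bochner_approx a b f (s_ : nat -> R -> X) :=
  [/\ forall n, simple_fun (s_ n),
      {ae lebesgue_measure, forall t : R,
        a <= t <= b -> s_ n t @[n --> \oo] --> f t} &
      (\int[lebesgue_measure]_(t in `[a, b])
        (complex.Re `|f t - s_ n t|)%:E)%E @[n --> \oo] --> 0%E].

Definition bochner_integrable a b f := exists s_, bochner_approx a b f s_.

(* The limit of the integrals of any approximating sequence; 0 if there is    *)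
(* none.                                                                      *)
Definition bochner_integral a b f : X :=
  xget 0 [set v | exists2 s_, bochner_approx a b f s_ &
                    simple_integral a b (s_ n) @[n --> \oo] --> v].

End bochner.

(* J : set R is coerced to the type {t : R | t \in J}, so J -> X is X^J.      *)
(* 'valL_ 0 f : R -> X is the extension of f : J -> X by 0 outside J.         *)
Section spaces.
Context {R : realType}.

Definition admissible_domain (J : set R) :=
  [\/ exists alpha : R, J = `[alpha, +oo[%classic,
      exists alpha : R, J = `]alpha, +oo[%classic | J = setT].

Definition g (omega r t : R) : R[i] :=
  cos (omega * `|t| `^ r) +i* sin (omega * `|t| `^ r).

Context (J : set R) (X : completeNormedModType R[i]).
Implicit Types (f : J -> X) (A B : set (J -> X)).

Definition UC : set (J -> X) := [set f | unif_continuous f].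

Definition C0 : set (J -> X) :=
  [set f | [/\ UC f,
      'valL_ 0 f t @[t --> +oo] --> (0 : X) &
      J = setT -> 'valL_ 0 f t @[t --> -oo] --> (0 : X)]].

Definition L1loc : set (J -> X) :=
  [set f | forall a b : R, a <= b -> `[a, b] `<=` J ->
    bochner_integrable a b ('valL_ 0 f)].

Definition mean (h : R) f : J -> X :=
  fun t => (h^-1)%:C *: bochner_integral 0 h (fun s => 'valL_ 0 f (\val t + s)).

Definition M B : set (J -> X) :=
  [set f | L1loc f /\ forall h : R, 0 < h -> B (mean h f)].

Definition mulset (gamma : R -> R[i]) A : set (J -> X) :=
  [set (fun t : J => gamma (\val t) *: f t) | f in A].

End spaces.

Arguments UC {R} J X.
Arguments C0 {R} J X.
Arguments L1loc {R} J X.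
Arguments mean {R J X} h f.
Arguments M {R J X} B.
Arguments mulset {R J X} gamma A.

(* Main.v *)
Require Import Defs.
From mathcomp Require Import all_boot all_order all_algebra.
From mathcomp Require Import all_classical all_reals all_analysis.
From mathcomp Require Import complex measurable_realfun ring lra finmap.
Import Order.TTheory GRing.Theory Num.Theory.
Import numFieldNormedType.Exports.
Import Normc.
Local Open Scope classical_set_scope.
Local Open Scope ring_scope.

(** Write g for the oscillating factor. It has modulus 1, it is Lipschitz on
    bounded intervals, but it is not uniformly continuous on J.

    The inclusion of M C0 in M (g A) holds because C0 is stable under
    multiplication by the conjugate of g (conj_g_C0): near infinity a function
    of C0 is small, so only uniform continuity on bounded parts of J has to be
    kept (C0P), and there g is harmless. Hence each mean of f is g times an
    element of C0, which is an element of A.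

    For the inclusion of g A in M C0, let f be uniformly continuous. Then f
    grows at most linearly (unif_continuous_growth). Cut [t, t + h] into N
    pieces on each of which f varies by at most e. Freezing f on every piece
    costs h e, and leaves N products of a value of f by the integral of g over
    a short interval. Since sin (omega s^r) s^(1-r) / (omega r) is a primitive
    of cos (omega s^r) up to O(s^-r), such an integral is O(|t|^(1-r))
    (phase_riemann_sum). So the integral of g f over [t, t + h] is at most
    h e + O(N |t|^(2-r)) (oscillatory_integral), and r > 2 makes the second
    term vanish at infinity (mean_vanishing). Uniform continuity of the means
    on bounded parts comes from that of g f.

    Only integrals of uniformly continuous functions on compact intervals
    occur. For them the Bochner integral is within e (b - a) of any Riemann sum
    whose mesh makes the oscillation at most e (bochner_riemann), and the
    whole argument above is carried out on Riemann sums. Independence of the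
    approximating sequence rests on simple_integral_dist. *)

Set Implicit Arguments.
Unset Strict Implicit.
Local Open Scope complex_scope.

(** * Norms in X as real numbers *)

Section real_norm.
Context {R : realType} {X : completeNormedModType R[i]}.
Implicit Types (x y : X) (c : R) (z : R[i]).

(** Norms of X take values in R[i]; every estimate below is between real
    numbers, and this is the norm as one of them. *)
Definition nm x : R := complex.Re `|x|.

Lemma nmE x : `|x| = (nm x)%:C.
Proof. by rewrite /nm RRe_real ?normr_real. Qed.

Lemma nm_ge0 x : 0 <= nm x.
Proof. by rewrite -ler0c -nmE. Qed.

Lemma nm0 : nm 0 = 0.
Proof. by rewrite /nm normr0. Qed.

Lemma nmN x : nm (- x) = nm x.
Proof. by rewrite /nm normrN. Qed.

Lemma nmD x y : nm (x + y) <= nm x + nm y.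
Proof. by rewrite -lecR rmorphD/= -!nmE ler_normD. Qed.

Lemma nmC x y : nm (x - y) = nm (y - x).
Proof. by rewrite -nmN opprB. Qed.

Lemma nm_trans x y w : nm (x - w) <= nm (x - y) + nm (y - w).
Proof. by apply: le_trans (nmD _ _); rewrite subrKA. Qed.

Lemma nm_dist x y : nm x <= nm (x - y) + nm y.
Proof. by apply: le_trans (nmD _ _); rewrite subrK. Qed.

Lemma normr_normc z : `|z| = (normc z)%:C.
Proof. by []. Qed.

Lemma nmZ z x : nm (z *: x) = normc z * nm x.
Proof. by apply: complexI; rewrite rmorphM/= -!nmE normrZ normr_normc. Qed.

Lemma normc_ge0 z : 0 <= normc z.
Proof. by case: z => ? ?; exact: sqrtr_ge0. Qed.

Lemma normcR c : normc c%:C = `|c|.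
Proof. by rewrite /normc/= expr0n/= addr0 sqrtr_sqr. Qed.

Lemma nmZr c x : nm (c%:C *: x) = `|c| * nm x.
Proof. by rewrite nmZ normcR. Qed.

Lemma normc_le_ReIm z : normc z <= `|complex.Re z| + `|complex.Im z|.
Proof.
case: z => a b /=; rewrite -[leRHS]ger0_norm ?addr_ge0// -sqrtr_sqr.
rewrite ler_wsqrtr// -(real_normK (num_real a)) -(real_normK (num_real b)).
by rewrite sqrrD addrAC lerDl mulrn_wge0 ?mulr_ge0.
Qed.

Lemma nm_sum (I : Type) (r : seq I) (P : pred I) (F : I -> X) :
  nm (\sum_(i <- r | P i) F i) <= \sum_(i <- r | P i) nm (F i).
Proof.
elim/big_ind2 : _ => [|x1 x2 y1 y2 h1 h2|//]; first by rewrite nm0.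
exact: le_trans (nmD _ _) (lerD h1 h2).
Qed.

Lemma ballE x y (e : R) : ball x e%:C y <-> nm (x - y) < e.
Proof. by rewrite -ball_normE /ball_/= nmE ltcR. Qed.

Lemma gt0_complexE (e : R[i]) : 0 < e -> exists2 d : R, 0 < d & e = d%:C.
Proof.
move=> e0; exists (complex.Re e); last by rewrite RRe_real ?gtr0_real.
by rewrite -ltcR RRe_real ?gtr0_real.
Qed.

Lemma cvg_nmP (T : Type) (F : set_system T) {FF : Filter F} (f : T -> X) x :
  f @ F --> x <-> forall e : R, 0 < e -> \forall t \near F, nm (x - f t) < e.
Proof.
split=> [/cvg_ballP fx e e0|fx].
  have /fx : 0 < e%:C :> R[i] by rewrite ltcR.
  by apply: filterS => t /ballE.
apply/cvg_ballP => _ /gt0_complexE[d d0 ->].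
by apply: filterS (fx _ d0) => t /ballE.
Qed.

Lemma cauchy_nm_cvg (u : nat -> X) :
  (forall e : R, 0 < e -> exists N, forall m n, (N <= m)%N -> (N <= n)%N ->
     nm (u m - u n) < e) -> exists x, u @ \oo --> x.
Proof.
move=> uC; suff: cvgn u by move=> h; exists (limn u).
apply/cauchy_cvgP; apply/cauchy_ballP => _ /gt0_complexE[d d0 ->].
have [N hN] := uC _ d0.
exists (u @` [set n | (N <= n)%N], u @` [set n | (N <= n)%N]) => /=.
  by split; apply: filterS (nbhs_infty_ge N) => n Nn; exists n.
by move=> [_ _] /= [[m mN <-] [n nN <-]]; apply/ballE; exact: hN.
Qed.

End real_norm.

(** * Functions on J as functions on the line *)

Section domain.
Context {R : realType} {X : completeNormedModType R[i]} {J : set R}.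
Implicit Types (f F : J -> X).

Local Notation ext := ('valL_ (0 : X)).

Lemma valLE f (t : J) : ext f (\val t) = f t.
Proof.
rewrite /valL_ oinv_set_val/= insubT; first exact: valP.
by move=> Jt; congr (f _); exact: val_inj.
Qed.

Lemma valLout f (t : R) : ~ J t -> ext f t = 0.
Proof. by move=> Jt; rewrite /valL_/= oinv_set_val insubN// notin_setE. Qed.

(** J is metric over R and X over R[i], so the radii of balls live in different
    fields; the proof passes through entourages. *)
Lemma unif_continuous_nmP f : unif_continuous f <->
  forall e : R, 0 < e -> exists2 d : R, 0 < d & forall s t, J s -> J t ->
    `|s - t| < d -> nm (ext f s - ext f t) < e.
Proof.
split=> [uf e e0|uf V].
  have : entourage [set xy : X * X | ball xy.1 e%:C xy.2].
    by rewrite -entourage_ballE; exists e%:C => //=; rewrite ltcR.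
  move=> /uf[/= W]; rewrite -entourage_ballE => -[d/= d0 dW] WV; exists d => // s t Js Jt st.
  pose s' : J := SigSub (mem_set Js); pose t' : J := SigSub (mem_set Jt).
  suff : nm (f s' - f t') < e by rewrite -!valLE.
  by apply/ballE; apply: (WV (s', t')); apply: dW.
rewrite -entourage_ballE => -[/= _ /gt0_complexE[e e0 ->] eV].
have [d d0 fd] := uf _ e0.
exists [set xy : R * R | ball xy.1 d xy.2].
  by rewrite -entourage_ballE; exists d.
move=> [s t]/= st; apply: eV; apply/ballE.
rewrite -!valLE; apply: fd; [exact/set_mem/valP|exact/set_mem/valP|exact: st].
Qed.

End domain.

(** * Simple functions and their integrals *)

Section integral_monotone.
Local Open Scope ereal_scope.
Context d (T : measurableType d) (R : realType).
Variable mu : {measure set T -> \bar R}.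

(** The integral of a nonnegative function is a supremum over the simple
    functions below it, hence monotone on all functions. It is applied to norms
    of u - s with s simple and u arbitrary. *)
Lemma lower_integral_mono (D : set T) (f1 f2 : T -> \bar R) :
  (forall x, D x -> 0 <= f1 x) -> (forall x, D x -> f1 x <= f2 x) ->
  \int[mu]_(x in D) f1 x <= \int[mu]_(x in D) f2 x.
Proof.
move=> f10 f12.
have f20 x : D x -> 0 <= f2 x by move=> Dx; exact: le_trans (f10 _ Dx) (f12 _ Dx).
rewrite !ge0_integralE//; apply: ereal_sup_le => _ [h hf <-].
by exists h => // x; apply: le_trans (hf x) _; exact: lee_restrict.
Qed.

End integral_monotone.

Section simple_functions.
Context {R : realType} {X : completeNormedModType R[i]}.
Variables (a b : R).
Implicit Types (s S u : R -> X).

Local Notation mu := (@lebesgue_measure R).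

Section fibers.
Context {T : choiceType} (k : R -> T) (D : {fset T}).
Hypothesis kD : forall t, k t \in D.
Hypothesis mk : forall i, measurable (k @^-1` [set i]).

Definition fiber_mass (i : T) : R := fine (mu (`[a, b]%classic `&` k @^-1` [set i])).

Let measurable_fiber i : measurable (`[a, b]%classic `&` k @^-1` [set i]).
Proof. by apply: measurableI => //; exact: measurable_itv. Qed.

Let mu_fin (A : set R) : measurable A -> mu (`[a, b]%classic `&` A) \is a fin_num.
Proof.
move=> mA; rewrite ge0_fin_numE ?measure_ge0//.
apply: (@le_lt_trans _ _ (mu `[a, b]%classic)).
  have mab : measurable `[a, b]%classic by exact: measurable_itv.
  apply: le_measure => [| |t []//]; apply: mem_set => //.
  exact: measurableI mab mA.
by rewrite lebesgue_measure_itv/=; case: ifP => // _; rewrite -EFinB ltry.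
Qed.

Lemma fiber_mass_ge0 i : 0 <= fiber_mass i.
Proof. exact/fine_ge0/measure_ge0. Qed.

Lemma fiber_massE i : (fiber_mass i)%:E = mu (`[a, b]%classic `&` k @^-1` [set i]).
Proof. by rewrite fineK// mu_fin. Qed.

(** Here k has finitely many values, all in D, and measurable fibres; integrals
    of functions that factor through k become finite sums over D. Taking for k
    a pair of simple functions gives a common refinement of both. *)
Lemma fiber_mass_cond (P : pred T) :
  fine (mu (`[a, b]%classic `&` [set t | P (k t)])) = \sum_(i <- D | P i) fiber_mass i.
Proof.
have -> : `[a, b]%classic `&` [set t | P (k t)] =
    \big[setU/set0]_(i <- [fset i in D | P i]%fset) (`[a, b]%classic `&` k @^-1` [set i]).
  rewrite -bigcup_fset; apply/seteqP; split=> [t/= [tab Pt]|t [i/=]].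
    by exists (k t) => //=; rewrite !inE/= kD.
  by rewrite !inE/= => /andP[_ Pi] [tab ->].
rewrite measure_fbigsetU; last 2 first.
- by move=> i _; exact: measurable_fiber.
- exact: trivIset_preimage1_in.
rewrite (eq_bigr (fun i => (fiber_mass i)%:E)) => [|i _]; last by rewrite fiber_massE.
by rewrite sumEFin/= big_fset.
Qed.

Lemma simple_integral_comp (c : T -> X) :
  simple_integral a b (c \o k) = \sum_(i <- D) (fiber_mass i)%:C *: c i.
Proof.
rewrite /simple_integral (@fsbig_widen _ _ _ _ _ [set` [fset c i | i in D]%fset]).
- rewrite -fsbig_seq ?fset_uniq// [RHS](partition_big_imfset _ c).
  apply: eq_bigr => x _; rewrite -/(mu) (_ : _ @^-1` _ = [set t | c (k t) == x]).
    by rewrite (fiber_mass_cond (fun i => c i == x)) rmorph_sum scaler_suml;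
      apply: eq_bigr => i /eqP ->.
  by apply/seteqP; split=> t /= /eqP.
- by move=> _ [t _ <-]; apply/imfsetP; exists (k t).
- move=> x [_ /= xk]; rewrite (_ : _ `&` _ = set0) ?measure0 ?scale0r//.
  by rewrite -subset0 => t [_ /= ktx]; apply: xk; exists t.
Qed.

Lemma integral_comp (F : T -> R) : (forall i, 0 <= F i) ->
  (\int[mu]_(t in `[a, b]) (F (k t))%:E)%E =
  (\sum_(i <- D) fiber_mass i * F i)%:E.
Proof.
move=> F0.
have abE : `[a, b]%classic = \big[setU/set0]_(i <- D) (`[a, b]%classic `&` k @^-1` [set i]).
  rewrite -bigcup_fset; apply/seteqP; split=> [t/= tab|t [i/= _ []]//].
  by exists (k t) => //=; rewrite kD.
have mF : measurable_fun `[a, b]%classic (F \o k).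
  move=> mab Y _; rewrite (_ : _ @^-1` Y =
      \bigcup_(i in [set` D] `&` [set i | Y (F i)]) (k @^-1` [set i])).
    apply: measurableI => //.
    by apply: fin_bigcup_measurable => //; exact: finite_setIl.
  apply/seteqP; split=> [t Yt|t [i [_ Yi] /= ->]//].
  by exists (k t) => //; split=> //=; rewrite kD.
rewrite abE ge0_integral_bigsetU//; last 3 first.
- exact: trivIset_preimage1_in.
- by rewrite -abE; apply/measurable_EFinP.
- by move=> t _; rewrite lee_fin.
- rewrite -sumEFin; apply: eq_bigr => i _; rewrite EFinM fiber_massE muleC.
  rewrite -(integral_cst mu (measurable_fiber i)).
  by apply: eq_integral => t /set_mem[_ /= ->].
Qed.

Lemma sum_fiber_mass : a <= b -> \sum_(i <- D) fiber_mass i = b - a.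
Proof.
move=> ab; rewrite -(fiber_mass_cond xpredT).
have -> : [set t | xpredT (k t)] = setT by apply/seteqP.
rewrite setIT lebesgue_measure_itv/= lte_fin; case: ltP => // ba.
by apply/esym/eqP; rewrite subr_eq0 eq_le ab ba.
Qed.

End fibers.

(** The key estimate: u is uniformly close to S and close in mean to s. With
    F the norm of s - S, the truncation max (0, F - e) is a simple function
    below the norm of u - s, so its integral is at most that of the latter even
    if u is not measurable, and F is at most this truncation plus e. *)
Lemma simple_integral_dist u s S (e : R) : a <= b ->
  simple_fun s -> simple_fun S -> (forall t, a <= t <= b -> nm (u t - S t) <= e) ->
  ((nm (simple_integral a b s - simple_integral a b S))%:E <=
   \int[mu]_(t in `[a, b]) (nm (u t - s t))%:E + (e * (b - a))%:E)%E.
Proof.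
move=> ab [fs ms] [fS mS] uS.
have e0 : 0 <= e by apply: le_trans (uS a _); rewrite ?nm_ge0// lexx.
pose k t := (s t, S t).
have fk : finite_set (range k).
  by apply: sub_finite_set (finite_setX fs fS) => _ [t _ <-]; split=> /=; exists t.
pose D := fset_set (range k).
have kD t : k t \in D by rewrite in_fset_set//; apply: mem_set; exists t.
have mk i : measurable (k @^-1` [set i]).
  rewrite (_ : _ @^-1` _ = s @^-1` [set i.1] `&` S @^-1` [set i.2]).
    exact: measurableI.
  apply/seteqP; case: i => i j; split=> t /= [si Sj]; first by split.
  by rewrite /k si Sj.
have -> : s = fst \o k by [].
have -> : S = snd \o k by [].
rewrite !(simple_integral_comp kD mk) -sumrB.
(* F truncates the norm of s - S, read on the pair of their values. *)
pose F (i : X * X) : R := Num.max 0 (nm (i.1 - i.2) - e).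
apply: (@le_trans _ _ (\sum_(i <- D) fiber_mass k i * F i +
    e * (\sum_(i <- D) fiber_mass k i))%:E).
  rewrite lee_fin mulr_sumr -big_split/=; apply: le_trans (nm_sum _ _ _) _.
  apply: ler_sum => i _; rewrite -scalerBr nmZr ger0_norm ?fiber_mass_ge0//.
  rewrite [e * _]mulrC -mulrDr ler_wpM2l ?fiber_mass_ge0//.
  by rewrite -lerBlDr /F le_max lexx orbT.
rewrite EFinD (sum_fiber_mass kD mk ab) leeD2r//.
rewrite -(integral_comp kD mk); last by move=> i; rewrite /F le_max lexx.
apply: lower_integral_mono => t; first by rewrite lee_fin /F le_max lexx.
rewrite /= in_itv/= => tab; rewrite lee_fin /F/= ge_max nm_ge0/= lerBlDr.
by apply: le_trans (nm_trans _ (u t) _) _; rewrite nmC lerD2l uS.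
Qed.

Lemma integral_le_unif u S (e : R) : a <= b ->
  (forall t, a <= t <= b -> nm (u t - S t) <= e) ->
  (\int[mu]_(t in `[a, b]) (nm (u t - S t))%:E <= (e * (b - a))%:E)%E.
Proof.
move=> ab uS; apply: (@le_trans _ _ (\int[mu]_(t in `[a, b]) (cst e%:E) t)%E).
  apply: lower_integral_mono => t; first by rewrite lee_fin nm_ge0.
  by rewrite /= in_itv/= => tab; rewrite lee_fin uS.
rewrite integral_cst//= lebesgue_measure_itv/= lte_fin.
case: ltP => _; first by rewrite -EFinB -EFinM.
by rewrite mule0 lee_fin mulr_ge0 ?subr_ge0// (le_trans _ (uS a _)) ?nm_ge0 ?lexx.
Qed.

(** Any value of the Bochner integral of u, whatever the approximating sequence
    it comes from, is close to the integral of a uniformly close simple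
    function. *)
Lemma limit_simple_integral_dist u (s_ : nat -> R -> X) S v (e : R) : a <= b ->
  bochner_approx a b u s_ -> simple_integral a b (s_ n) @[n --> \oo] --> v ->
  simple_fun S -> (forall t, a <= t <= b -> nm (u t - S t) <= e) ->
  nm (v - simple_integral a b S) <= e * (b - a).
Proof.
move=> ab [ss _ us] sv fS uS; apply/ler_addgt0Pr => d d0.
have d2 : 0 < d / 2 by rewrite divr_gt0.
have h1 : \forall n \near \oo, nm (v - simple_integral a b (s_ n)) < d / 2.
  by move/cvg_nmP : sv; apply.
have h2 : \forall n \near \oo,
    (\int[mu]_(t in `[a, b]) (nm (u t - s_ n t))%:E < (d / 2)%:E)%E.
  have : nbhs 0%E [set x : \bar R | (x < (d / 2)%:E)%E].
    by apply: open_nbhs_nbhs; split; [exact: open_ereal_lt_ereal|rewrite /= lte_fin].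
  exact: us.
have [n [n1 n2]] := filter_ex (filterI h1 h2).
have n3 := simple_integral_dist ab (ss n) fS uS.
have {n2 n3} : nm (simple_integral a b (s_ n) - simple_integral a b S) <=
    d / 2 + e * (b - a).
  by rewrite -lee_fin EFinD (le_trans n3)// leeD2r// ltW.
have := nm_trans v (simple_integral a b (s_ n)) (simple_integral a b S).
by move: n1; lra.
Qed.

End simple_functions.

(** * The Bochner integral as a limit of Riemann sums *)

Section riemann_sums.
Context {R : realType} {X : completeNormedModType R[i]}.
Implicit Types (a b : R) (u : R -> X).

Local Notation mu := (@lebesgue_measure R).

(** The number of the piece of the regular subdivision of [a, b] into n pieces
    that contains t. The piece number n is the singleton b; if a = b then
    division by zero yields index 0, so that degenerate intervals need no
    separate treatment below. *)
Definition grid_index a b n (t : R) : nat :=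
  minn n (Num.truncn ((t - a) / (b - a) * n%:R)).

Definition grid_step a b n u (t : R) : X :=
  u (a + (b - a) / n%:R * (grid_index a b n t)%:R).

Lemma grid_index_in a b n t : grid_index a b n t \in fset_set `I_n.+1.
Proof. by rewrite in_fset_set//; apply: mem_set; rewrite /= ltnS geq_minl. Qed.

(** The index is monotone in t, hence its fibres are intervals. *)
Lemma measurable_grid_index a b n i : a <= b ->
  measurable (grid_index a b n @^-1` [set i]).
Proof.
move=> ab; apply: is_interval_measurable => s t /= si ti x /andP[sx xt].
have mono (y z : R) : y <= z -> (grid_index a b n y <= grid_index a b n z)%N.
  move=> yz; rewrite leq_min geq_minl/= (leq_trans (geq_minr _ _))//.
  by rewrite le_truncn// ler_wpM2r// ler_wpM2r ?invr_ge0 ?subr_ge0// lerD2r.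
by apply/eqP; rewrite eqn_leq; apply/andP; split; [rewrite -ti|rewrite -si]; exact: mono.
Qed.

Lemma simple_grid_step a b n u : a <= b -> simple_fun (grid_step a b n u).
Proof.
move=> ab; split.
  apply: (@sub_finite_set _ _ ((fun i : nat => u (a + (b - a) / n%:R * i%:R)) @` `I_n.+1)).
    by move=> _ [t _ <-]; exists (grid_index a b n t) => //=; rewrite ltnS geq_minl.
  by apply: finite_image; exact: finite_II.
move=> x; rewrite (_ : _ @^-1` _ = \bigcup_(i in `I_n.+1 `&`
    [set i | u (a + (b - a) / n%:R * i%:R) = x]) (grid_index a b n @^-1` [set i])).
  apply: fin_bigcup_measurable; first by apply: finite_setIl; exact: finite_II.
  by move=> i _; exact: measurable_grid_index.
apply/seteqP; split=> [t /= tx|t [i [_ /= ix] /= ti]].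
  by exists (grid_index a b n t) => //=; split=> //; rewrite ltnS geq_minl.
by rewrite /grid_step ti.
Qed.

Lemma grid_index_eq a b n t i : a < b -> (0 < n)%N -> a <= t <= b ->
  (grid_index a b n t == i) =
  (a + (b - a) / n%:R * i%:R <= t < a + (b - a) / n%:R * i.+1%:R).
Proof.
move=> ab n0 /andP[ta tb]; have ba0 : 0 < b - a by rewrite subr_gt0.
have nR : 0 < n%:R :> R by rewrite ltr0n.
have d0 : 0 < (b - a) / n%:R by rewrite divr_gt0.
rewrite /grid_index; set x := (t - a) / (b - a) * n%:R.
have xE : x = (t - a) / ((b - a) / n%:R).
  by rewrite /x; field; rewrite !gt_eqF.
have x0 : 0 <= x by rewrite xE divr_ge0 ?subr_ge0// ltW.
have xn : x <= n%:R by rewrite /x ler_piMl ?ler0n// ler_pdivrMr// mul1r lerD2r.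
rewrite (minn_idPr _); last by rewrite truncn_le_nat (le_lt_trans xn)// ltr_nat.
rewrite truncn_eq// xE ler_pdivlMr// ltr_pdivrMr// lerBrDl ltrBlDl.
by rewrite ![_ * (_ / _)]mulrC.
Qed.

Lemma grid_point_near a b n t : (0 < n)%N -> a <= t <= b ->
  let p := a + (b - a) / n%:R * (grid_index a b n t)%:R in
  a <= p <= b /\ `|t - p| <= (b - a) / n%:R.
Proof.
move=> n0 tab; have /andP[ta tb] := tab.
have [ab|ba] := ltP a b; last first.
  have -> : b = a by apply/eqP; rewrite eq_le ba (le_trans ta tb).
  have -> : t = a by apply/eqP; rewrite eq_le ta (le_trans tb ba).
  by rewrite /= subrr !mul0r addr0 lexx subrr normr0.
have d0 : 0 < (b - a) / n%:R by rewrite divr_gt0 ?ltr0n// subr_gt0.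
have := eqxx (grid_index a b n t); rewrite grid_index_eq// => /andP[].
rewrite -natr1 mulrDr mulr1 addrA /=; set p := (a + _ * _) => pt tp.
split; first by rewrite (le_trans pt tb) andbT lerDl mulr_ge0 ?ler0n// ltW.
by rewrite ger0_norm ?subr_ge0// lerBlDl ltW.
Qed.

Lemma simple_integral_grid_step a b n u : a < b -> (0 < n)%N ->
  simple_integral a b (grid_step a b n u) =
  \sum_(i < n) ((b - a) / n%:R)%:C *: u (a + (b - a) / n%:R * i%:R).
Proof.
move=> ab n0; have nR : 0 < n%:R :> R by rewrite ltr0n.
have d0 : 0 < (b - a) / n%:R by rewrite divr_gt0// subr_gt0.
pose c (i : nat) := u (a + (b - a) / n%:R * i%:R).
rewrite -[grid_step _ _ _ _]/(c \o grid_index a b n).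
rewrite (simple_integral_comp a b (@grid_index_in a b n)
  (fun i => measurable_grid_index n i (ltW ab))).
rewrite -fsbig_finite//= -(fsbig_ord _ n.+1
  (fun i => (fiber_mass a b (grid_index a b n) i)%:C *: c i)) big_ord_recr/=.
have bE : a + (b - a) / n%:R * n%:R = b by field; rewrite gt_eqF.
rewrite [X in _ + X](_ : _ = 0) ?addr0; last first.
  rewrite /fiber_mass (_ : _ `&` _ = [set b]) ?lebesgue_measure_set1 ?scale0r//.
  apply/seteqP; split=> [t [/=]|t /= ->].
    rewrite in_itv/= => tab /eqP; rewrite grid_index_eq// bE => /andP[bt _].
    by apply/eqP; rewrite eq_le bt; case/andP: tab => _ ->.
  have bab : a <= b <= b by rewrite lexx ltW.
  split; rewrite /= ?in_itv//; apply/eqP; rewrite grid_index_eq// bE lexx/=.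
  by rewrite -[ltLHS]bE ltrD2l ltr_pM2l// ltr_nat.
apply: eq_bigr => i _; congr (_%:C *: _).
pose p := a + (b - a) / n%:R * i%:R; pose q := a + (b - a) / n%:R * i.+1%:R.
have pq : p < q by rewrite ltrD2l ltr_pM2l// ltr_nat.
rewrite /fiber_mass (_ : _ `&` _ = `[p, q[%classic).
  rewrite lebesgue_measure_itv/= lte_fin pq -EFinB/=.
  by rewrite /p /q -natr1; ring.
have ap : a <= p by rewrite lerDl mulr_ge0 ?ler0n// ltW.
have qb : q <= b by rewrite -bE lerD2l ler_pM2l// ler_nat.
apply/seteqP; split=> t /=; rewrite !in_itv/=.
  by move=> [tab /eqP]; rewrite grid_index_eq.
move=> /andP[pt tq].
have tab : a <= t <= b by rewrite (le_trans ap pt) (le_trans (ltW tq) qb).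
by split=> //; apply/eqP; rewrite grid_index_eq// pt tq.
Qed.

Definition unif_cont_on a b u := forall e : R, 0 < e -> exists2 d : R, 0 < d &
  forall s t, a <= s <= b -> a <= t <= b -> `|s - t| < d -> nm (u s - u t) < e.

Lemma grid_step_unif a b u : a <= b -> unif_cont_on a b u ->
  forall e : R, 0 < e -> exists N, forall n, (N <= n)%N -> forall t,
    a <= t <= b -> nm (u t - grid_step a b n.+1 u t) < e.
Proof.
move=> ab uc e e0; have [d d0 ud] := uc e e0.
exists (Num.truncn ((b - a) / d)) => n Nn t tab.
have [pab tp] := grid_point_near (ltn0Sn n) tab.
apply: ud => //; apply: le_lt_trans tp _.
rewrite ltr_pdivrMr ?ltr0n// mulrC -ltr_pdivrMr//.
by apply: lt_le_trans (truncnS_gt _) _; rewrite ler_nat.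
Qed.

Lemma grid_step_approx a b u : a <= b -> unif_cont_on a b u ->
  bochner_approx a b u (fun n => grid_step a b n.+1 u).
Proof.
move=> ab uc; have h := grid_step_unif ab uc; split.
- by move=> n; exact: simple_grid_step.
- apply: aeW => t tab; apply/cvg_nmP => e /h[N hN].
  by exists N => // n /= /hN; apply.
- have le_int (e : R) : 0 < e -> \forall n \near \oo,
     (\int[mu]_(t in `[a, b]) (nm (u t - grid_step a b n.+1 u t))%:E
       <= (e * (b - a))%:E)%E.
    move=> /h[N hN]; exists N => // n /= /hN hn.
    by apply: integral_le_unif => // t /hn/ltW.
  have ge_int n :
     (0 <= \int[mu]_(t in `[a, b]) (nm (u t - grid_step a b n.+1 u t))%:E)%E.
    by apply: integral_ge0 => t _; rewrite lee_fin nm_ge0.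
  suff: (\int[mu]_(t in `[a, b]) (nm (u t - grid_step a b n.+1 u t))%:E)%E
      @[n --> \oo] --> 0%E by [].
  apply/fine_cvgP; split.
    apply: filterS (le_int 1 ltr01) => n hn.
    by rewrite ge0_fin_numE//; apply: le_lt_trans hn _; rewrite ltry.
  apply/cvgrPdist_le => e e0.
  have d0 : 0 < b - a + 1 by rewrite ltr_wpDl// subr_ge0.
  apply: filterS (le_int (e / (b - a + 1)) (divr_gt0 e0 d0)) => n hn.
  rewrite sub0r normrN ger0_norm ?fine_ge0// -lee_fin fineK; last first.
    by rewrite ge0_fin_numE//; apply: le_lt_trans hn _; rewrite ltry.
  apply: le_trans hn _; rewrite lee_fin mulrAC ler_pdivrMr//.
  by rewrite ler_wpM2l ?lerDl// ltW.
Qed.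

(** Integrals of step functions on finer and finer grids form a Cauchy sequence
    and X is complete, so xget does pick a limit. *)
Lemma bochner_integralP a b u : a <= b -> unif_cont_on a b u ->
  exists2 s_, bochner_approx a b u s_ &
    simple_integral a b (s_ n) @[n --> \oo] --> bochner_integral a b u.
Proof.
move=> ab uc; rewrite /bochner_integral.
set V := [set v | _]; suff : exists v, V v by move=> /(xgetPex 0).
have approx := grid_step_approx ab uc.
have [v hv] : exists v : X, simple_integral a b (grid_step a b n.+1 u) @[n --> \oo] --> v.
  apply: cauchy_nm_cvg => e e0.
  have d0 : 0 < 2 * (b - a) + 1 by rewrite ltr_wpDl// mulr_ge0// subr_ge0.
  have [N hN] := grid_step_unif ab uc (divr_gt0 e0 d0).
  exists N => m n /hN hm /hN hn.
  have mab t : a <= t <= b -> nm (u t - grid_step a b m.+1 u t) <= e / (2 * (b - a) + 1).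
    by move=> /hm/ltW.
  have nab t : a <= t <= b -> nm (u t - grid_step a b n.+1 u t) <= e / (2 * (b - a) + 1).
    by move=> /hn/ltW.
  have := simple_integral_dist ab (simple_grid_step m.+1 u ab)
    (simple_grid_step n.+1 u ab) nab.
  move=> /le_trans /(_ (leeD2r _ (integral_le_unif ab mab))).
  rewrite -EFinD lee_fin => /le_lt_trans; apply.
  have k0 := divr_gt0 e0 d0.
  by rewrite -[ltRHS](divfK (lt0r_neq0 d0)); move: k0; set k := e / _; lra.
by exists v; exists (fun n => grid_step a b n.+1 u).
Qed.

Lemma bochner_riemann a b u n (e : R) : a < b -> (0 < n)%N -> unif_cont_on a b u ->
  (forall s t, a <= s <= b -> a <= t <= b -> `|s - t| <= (b - a) / n%:R ->
     nm (u s - u t) <= e) ->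
  nm (bochner_integral a b u -
      \sum_(i < n) ((b - a) / n%:R)%:C *: u (a + (b - a) / n%:R * i%:R)) <= e * (b - a).
Proof.
move=> ab n0 uc ue; have [s_ sa sv] := bochner_integralP (ltW ab) uc.
rewrite -simple_integral_grid_step//.
apply: (limit_simple_integral_dist (ltW ab) sa sv).
  exact: simple_grid_step (ltW ab).
move=> t tab; have [pab tp] := grid_point_near n0 tab.
exact: ue.
Qed.

End riemann_sums.

(** * Riemann sums of the oscillating factor *)

Section oscillation.
Context {R : realType}.
Implicit Types (a l x y s t T A eta omega r theta : R).

Lemma mean_value (f df : R -> R) a b : a <= b ->
  (forall x, a <= x <= b -> is_derive x 1 f (df x)) ->
  exists2 c, a <= c <= b & f b - f a = df c * (b - a).
Proof.
move=> ab fd; have [||c cab fE] := @MVT_segment R f df a b ab.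
- by move=> x /subset_itv_oo_cc; rewrite in_itv/= => /fd.
- apply: derivable_within_continuous => x; rewrite in_itv/= => /fd h.
  exact: ex_derive.
- by exists c => //; move: cab; rewrite in_itv.
Qed.

(** P is a primitive of G up to kappa. By the mean value theorem each term of
    the Riemann sum is an increment of P, up to l / n times kappa + eta, and
    the increments telescope. *)
Lemma riemann_sum_primitive (G P dP : R -> R) a l n (kappa M eta : R) :
  0 <= l -> (0 < n)%N ->
  (forall x, a <= x <= a + l ->
     [/\ is_derive x 1 P (dP x), `|dP x - G x| <= kappa & `|P x| <= M]) ->
  (forall x y, a <= x <= a + l -> a <= y <= a + l -> `|x - y| <= l / n%:R ->
     `|G x - G y| <= eta) ->
  `|\sum_(i < n) l / n%:R * G (a + l / n%:R * i%:R)| <= 2 * M + l * (kappa + eta).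
Proof.
move=> l0 n0 PG Geta; have nR : 0 < n%:R :> R by rewrite ltr0n.
set d := l / n%:R; have d0 : 0 <= d by rewrite divr_ge0// ltW.
pose p (i : nat) := a + d * i%:R.
have nd : d * n%:R = l by rewrite /d divfK// gt_eqF.
have pin i : (i <= n)%N -> a <= p i <= a + l.
  move=> i_n; rewrite lerDl mulr_ge0//= lerD2l -nd.
  by rewrite ler_wpM2l// ler_nat.
have pS i : p i.+1 - p i = d by rewrite /p -natr1; ring.
have step (i : 'I_n) : `|d * G (p i) - (P (p i.+1) - P (p i))| <= d * (kappa + eta).
  have pi1 := pin _ (ltnW (ltn_ord i)); have pi2 := pin _ (ltn_ord i).
  have pp : p i <= p i.+1 by rewrite -subr_ge0 pS.
  have [x /andP[xp px]|c /andP[cp pc] ->] := @mean_value P dP _ _ pp.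
    case/andP: pi1 => ap _; case/andP: pi2 => _ pl.
    by have [] := PG x _; rewrite ?(le_trans ap xp) ?(le_trans px pl).
  have cin : a <= c <= a + l.
    case/andP: pi1 => ap _; case/andP: pi2 => _ pl.
    by rewrite (le_trans ap cp) (le_trans pc pl).
  rewrite pS mulrC -mulrBl normrM (ger0_norm d0) mulrC ler_wpM2l//.
  have [_ h _] := PG c cin.
  rewrite -(subrKA (G c)) addrC (le_trans (ler_normD _ _))// lerD//.
    by rewrite distrC.
  by apply: Geta => //; rewrite distrC ger0_norm ?subr_ge0// -[leRHS](pS i) lerD2r.
have tele : \sum_(i < n) (P (p i.+1) - P (p i)) = P (p n) - P (p 0%N).
  by rewrite -(big_mkord xpredT (fun i => P (p i.+1) - P (p i))) telescope_sumr.
rewrite -[X in `|X|](subrK (P (p n) - P (p 0%N))) (le_trans (ler_normD _ _))//.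
rewrite addrC lerD//.
  have [_ _ h1] := PG _ (pin _ (leqnn n)); have [_ _ h2] := PG _ (pin _ (leq0n n)).
  by rewrite mulr_natl mulr2n (le_trans (ler_normB _ _))// lerD.
rewrite -tele -sumrB (le_trans (ler_norm_sum _ _ _))//.
apply: (@le_trans _ _ (\sum_(i < n) d * (kappa + eta))).
  by apply: ler_sum => i _; exact: step.
by rewrite sumr_const card_ord -mulrnAl -mulr_natr nd.
Qed.

(** The shift theta = 0 gives the real part of g, and theta = - pi / 2 its
    imaginary part. *)
Definition phase omega r theta s : R := cos (omega * `|s| `^ r + theta).

Lemma cos_lipschitz x y : `|cos x - cos y| <= `|x - y|.
Proof.
wlog xy : x y / x <= y.
  by move=> h; have [/h//|/ltW/h] := leP x y; rewrite distrC [leRHS]distrC.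
have [c _ h] := @mean_value cos (fun z => - sin z) x y xy (fun z _ => is_derive_cos z).
rewrite distrC h normrM normrN [leRHS]distrC ler_piMl//; exact: sin_max.
Qed.

(** The power function is differentiable only away from 0, so the case x = 0
    is separate: there y^r = y y^(r-1). *)
Lemma powR_lipschitz r T x y : 1 <= r -> 0 <= x -> x <= T -> 0 <= y -> y <= T ->
  `|x `^ r - y `^ r| <= r * T `^ (r - 1) * `|x - y|.
Proof.
move=> r1.
wlog xy : x y / x <= y.
  move=> h x0 xT y0 yT; have [xy|/ltW yx] := leP x y; first exact: h.
  by rewrite distrC [X in _ <= _ * X]distrC; exact: h.
move=> x0 xT y0 yT; rewrite distrC [X in _ <= _ * X]distrC.
have r0 : 0 <= r by rewrite (le_trans _ r1).
have T1 z : 0 <= z -> z <= T -> z `^ (r - 1) <= T `^ (r - 1).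
  by move=> z0 zT; rewrite ge0_ler_powR ?subr_ge0// nnegrE// (le_trans z0 zT).
have [x_gt0|x_le0] := ltP 0 x; last first.
  have -> : x = 0 by apply/eqP; rewrite eq_le x_le0.
  rewrite powR0 ?subr0; last by rewrite gt_eqF// (lt_le_trans _ r1).
  rewrite !ger0_norm ?powR_ge0// -mulr_powRB1// ?(lt_le_trans _ r1)//.
  by rewrite mulrC ler_wpM2r// (le_trans (T1 _ y0 yT))// ler_peMl ?powR_ge0.
have [z /andP[xz zy]|c /andP[xc cy] ->] :=
  @mean_value (fun z => z `^ r) (fun z => r * z `^ (r - 1)) x y xy.
  by apply: is_derive1_powR; exact: lt_le_trans xz.
rewrite normrM ler_wpM2r// ger0_norm ?mulr_ge0 ?powR_ge0// ler_wpM2l//.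
by rewrite T1 ?(le_trans cy)// (le_trans x0).
Qed.

Lemma phase_lipschitz omega r theta T s t : 1 <= r -> `|s| <= T -> `|t| <= T ->
  `|phase omega r theta s - phase omega r theta t|
    <= `|omega| * (r * T `^ (r - 1)) * `|s - t|.
Proof.
move=> r1 sT tT; rewrite (le_trans (cos_lipschitz _ _))//.
rewrite opprD addrACA subrr addr0 -mulrBr normrM -mulrA ler_wpM2l//.
rewrite (le_trans (powR_lipschitz r1 _ sT _ tT))//.
rewrite ler_wpM2l ?mulr_ge0 ?powR_ge0 ?(le_trans _ r1)//.
exact: ler_dist_dist.
Qed.

(** The boundary term of one integration by parts in the integral of the phase
    over positive s. *)
Definition phase_primitive omega r theta s : R :=
  sin (omega * s `^ r + theta) * s `^ (1 - r) / (omega * r).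

Definition phase_primitive' omega r theta s : R :=
  cos (omega * s `^ r + theta) +
  sin (omega * s `^ r + theta) * ((1 - r) / (omega * r) * s `^ (- r)).

Lemma phase_primitive_derive omega r theta s : omega != 0 -> r != 0 -> 0 < s ->
  is_derive s 1 (phase_primitive omega r theta) (phase_primitive' omega r theta s).
Proof.
move=> om0 r0 s0; rewrite /phase_primitive.
have h1 := is_derive1_powR r s0.
have h2 := is_derive1_powR (1 - r) s0.
apply: is_derive_eq.
rewrite /phase_primitive' /GRing.scale/= mulr0 add0r addr0.
have -> : 1 - r - 1 = - r by ring.
have -> : s `^ (1 - r) = (s `^ (r - 1))^-1 by rewrite -powRN opprB.
have a0 : s `^ (r - 1) != 0 by rewrite gt_eqF ?powR_gt0.
by field; rewrite a0 om0 r0.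
Qed.

Lemma phase_primitive_bounds omega r theta A s : omega != 0 -> 1 < r ->
  1 <= A -> A <= s ->
  `|phase_primitive' omega r theta s - phase omega r theta s| <= A `^ (1 - r) / `|omega| /\
  `|phase_primitive omega r theta s| <= A `^ (1 - r) / `|omega|.
Proof.
move=> om0 r1 A1 As.
have s0 : 0 < s by rewrite (lt_le_trans _ As)// (lt_le_trans _ A1).
have r0 : 0 < r by rewrite (lt_trans _ r1).
have A0 : 0 < A by rewrite (lt_le_trans _ A1).
have o0 : 0 < `|omega| by rewrite normr_gt0.
have sA : s `^ (1 - r) <= A `^ (1 - r).
  rewrite -(opprB r) !powRN lef_pV2 ?posrE ?powR_gt0//.
  by rewrite ge0_ler_powR ?nnegrE ?subr_ge0// ltW.
have sr : s `^ (- r) <= s `^ (1 - r).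
  by rewrite ler_powR ?(le_trans A1 As)// lerDr.
split.
  rewrite /phase_primitive' /phase (ger0_norm (ltW s0)) addrC addKr normrM.
  rewrite (le_trans (ler_piMl _ (sin_max _)))// !normrM normfV normrM.
  rewrite (ger0_norm (powR_ge0 _ _)) (gtr0_norm r0) distrC.
  rewrite (@ger0_norm _ (r - 1)) ?subr_ge0 ?(ltW r1)//.
  have -> : (r - 1) / (`|omega| * r) * s `^ (- r) = (r - 1) / r * s `^ (- r) / `|omega|.
    by field; rewrite !gt_eqF.
  rewrite ler_wpM2r ?invr_ge0//.
  rewrite -[leRHS]mul1r ler_pM ?powR_ge0 ?(le_trans sr)//.
    by rewrite divr_ge0 ?subr_ge0 ?ltW.
  by rewrite ler_pdivrMr// mul1r lerBlDr lerDl.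
rewrite /phase_primitive !normrM normfV normrM -mulrA.
rewrite (le_trans (ler_piMl _ (sin_max _)))//.
rewrite (ger0_norm (powR_ge0 _ _)) (gtr0_norm r0).
rewrite ler_pM ?powR_ge0 ?invr_ge0 ?mulr_ge0 ?(ltW r0)//.
by rewrite lef_pV2 ?posrE ?mulr_gt0// ler_peMr ?ltW.
Qed.

(** On intervals left of - A the primitive is reflected, the phase being
    even. *)
Lemma phase_riemann_sum omega r theta A a l n eta :
  omega != 0 -> 1 < r -> 1 <= A -> 0 <= l -> (0 < n)%N ->
  A <= a \/ a + l <= - A ->
  (forall x y, a <= x <= a + l -> a <= y <= a + l -> `|x - y| <= l / n%:R ->
     `|phase omega r theta x - phase omega r theta y| <= eta) ->
  `|\sum_(i < n) l / n%:R * phase omega r theta (a + l / n%:R * i%:R)|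
    <= (2 + l) * (A `^ (1 - r) / `|omega|) + l * eta.
Proof.
move=> om0 r1 A1 l0 n0 Aa Geta.
rewrite mulrDl -addrA -mulrDr.
have r0 : r != 0 by rewrite gt_eqF// (lt_trans _ r1).
have A0 : 0 < A by rewrite (lt_le_trans _ A1).
case: Aa => [Aa|aA].
  apply: (@riemann_sum_primitive _ (phase_primitive omega r theta)
    (phase_primitive' omega r theta)) => // x /andP[ax xl].
  have Ax := le_trans Aa ax; have [h1 h2] := phase_primitive_bounds theta om0 r1 A1 Ax.
  by split=> //; apply: phase_primitive_derive => //; exact: lt_le_trans Ax.
apply: (@riemann_sum_primitive _ (fun x => - phase_primitive omega r theta (- x))
    (fun x => phase_primitive' omega r theta (- x))) => // x /andP[ax xl].
have Ax : A <= - x by rewrite lerNr (le_trans xl aA).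
have [h1 h2] := phase_primitive_bounds theta om0 r1 A1 Ax.
have pN : phase omega r theta (- x) = phase omega r theta x by rewrite /phase normrN.
split; [|by rewrite -pN|by rewrite /= normrN].
have h3 := phase_primitive_derive theta om0 r0 (lt_le_trans A0 Ax).
have h4 : is_derive x 1 (-%R : R -> R) (-1) by exact: is_deriveN.
have h5 := is_deriveN (is_derive1_comp h3 h4).
by rewrite mulrN1 opprK in h5.
Qed.

End oscillation.

(** * Uniform continuity on bounded parts of J *)

Section local_uniform_continuity.
Context {R : realType} {X : completeNormedModType R[i]} {J : set R}.
Implicit Types (f : J -> X) (F : R -> X) (gamma : R -> R[i]).

Local Notation ext := ('valL_ (0 : X)).

(** The modulus of uniform continuity may depend on the bounded part of J. *)
Definition loc_unif_cont F := forall T e : R, 0 < e -> exists2 d : R, 0 < d &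
  forall s t, J s -> J t -> `|s| <= T -> `|t| <= T -> `|s - t| < d ->
    nm (F s - F t) < e.

Definition vanishing F := forall e : R, 0 < e -> exists A : R,
  forall t, J t -> A <= `|t| -> nm (F t) < e.

Definition loc_lipschitz gamma := forall T : R, exists2 L : R, 0 <= L &
  forall s t, `|s| <= T -> `|t| <= T -> normc (gamma s - gamma t) <= L * `|s - t|.

Lemma valL_mul gamma f :
  ext (fun s : J => gamma (\val s) *: f s) = (fun t => gamma t *: ext f t).
Proof.
apply/funext => t; have [Jt|Jt] := pselect (J t); last by rewrite !valLout// scaler0.
by rewrite -[t]/(\val (SigSub (mem_set Jt) : J)) !valLE.
Qed.

Hypothesis admJ : admissible_domain J.

Lemma admissible_up s t : J s -> s <= t -> J t.
Proof.
move: admJ => [[al ->]|[al ->]|->//] /=; rewrite !in_itv/= !andbT => ls st.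
  exact: le_trans st.
exact: lt_le_trans st.
Qed.

Lemma admissible_nonempty : exists t, J t.
Proof.
move: admJ => [[al ->]|[al ->]|->]; last by exists 0.
  by exists al; rewrite /= in_itv/= lexx.
by exists (al + 1); rewrite /= in_itv/= ltrDl ltr01.
Qed.

(** Unless J is the whole line, points of J of large modulus are nonnegative;
    hence in all cases infinity in J is described by the modulus alone. *)
Lemma admissible_left : J != setT -> exists A : R, forall t, J t -> A <= `|t| -> 0 <= t.
Proof.
move=> JT; have [al hal] : exists al, forall t, J t -> al <= t.
  move: admJ JT => [[al ->]|[al ->]|->]; last by rewrite eqxx.
    by exists al => t; rewrite /= in_itv/= andbT.
  by exists al => t; rewrite /= in_itv/= andbT => /ltW.
exists (`|al| + 1) => t /hal alt At; have [//|t0] := leP 0 t.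
by move: At; rewrite (ltr0_norm t0); have := ler_norm (- al); rewrite normrN; lra.
Qed.

(** A function that vanishes at infinity and is uniformly continuous on bounded
    parts is uniformly continuous: two points at distance less than 1 are
    either both of modulus at most A + 1 or both of modulus at least A. *)
Lemma C0P f : C0 J X f <-> loc_unif_cont (ext f) /\ vanishing (ext f).
Proof.
split=> [[/unif_continuous_nmP uf fy fNy]|[luf vf]].
  split=> [T e /uf[d d0 fd]|e e0]; first by exists d => // s t Js Jt _ _; exact: fd.
  have [A [_ hA]] : (\forall t \near +oo, nm (0 - ext f t) < e).
    by move/cvg_nmP : fy; apply.
  have [B hB] : exists B : R, forall t, J t -> B <= `|t| -> t < 0 -> nm (ext f t) < e.
    have [JT|JT] := pselect (J = setT).
      have [B [_ hB]] : (\forall t \near -oo, nm (0 - ext f t) < e).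
        by move: (fNy JT) => /cvg_nmP; apply.
      exists (1 - B) => t _ Bt t0; rewrite -[ext f t]subr0 nmC; apply: hB => /=.
      by move: Bt; rewrite (ltr0_norm t0); lra.
    have /admissible_left[B hB] : J != setT by apply/eqP.
    by exists B => t Jt /(hB _ Jt); rewrite leNgt => /negP.
  exists (Num.max (`|A| + 1) B) => t Jt; rewrite ge_max => /andP[At Bt].
  have [t0|t0] := ltP t 0; first exact: hB.
  rewrite -[ext f t]subr0 nmC; apply: hA => /=; move: At; rewrite (ger0_norm t0).
  by move: (ler_norm A); lra.
have cv (e : R) : 0 < e -> exists A : R,
    forall t, A <= `|t| -> nm (0 - ext f t) < e.
  move=> e0; have [A hA] := vf e e0; exists A => t At.
  have [Jt|Jt] := pselect (J t); first by rewrite nmC subr0 hA.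
  by rewrite valLout// subr0 nm0.
split.
- apply/unif_continuous_nmP => e e0; have e2 : 0 < e / 2 by rewrite divr_gt0.
  have [A hA] := vf _ e2; have [d d0 hd] := luf (A + 1) _ e0.
  exists (Num.min d 1); first by rewrite lt_min d0 ltr01.
  move=> s t Js Jt; rewrite lt_min => /andP[std st1].
  have tri := ler_dist_dist s t; have tri2 := ler_norm (`|s| - `|t|).
  have tri3 := ler_norm (`|t| - `|s|); rewrite distrC in tri3.
  have far : A <= `|s| -> A <= `|t| -> nm (ext f s - ext f t) < e.
    move=> As At; rewrite (le_lt_trans (nmD _ _))// nmN.
    by have := hA _ Js As; have := hA _ Jt At; lra.
  have [sA|sA] := leP `|s| (A + 1); last by apply: far; lra.
  by have [tA|tA] := leP `|t| (A + 1); [exact: hd|apply: far; lra].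
- apply/cvg_nmP => e /cv[A hA]; near=> t; apply: hA.
  rewrite (le_trans _ (ler_norm _))//; near: t; exact: nbhs_pinfty_ge (num_real _).
- move=> _; apply/cvg_nmP => e /cv[A hA]; near=> t; apply: hA.
  rewrite -normrN (le_trans _ (ler_norm _))// lerNr.
  near: t; exact: nbhs_ninfty_le (num_real _).
Unshelve. all: by end_near. Qed.

(** A segment of J of length at most n d / 2 is cut into n pieces of length less
    than d, on each of which f varies by at most 1. *)
Lemma unif_continuous_chain f (d : R) :
  (forall s t, J s -> J t -> `|s - t| < d -> nm (ext f s - ext f t) < 1) -> 0 < d ->
  forall n s t, J s -> J t -> `|s - t| <= n%:R * (d / 2) ->
    nm (ext f s - ext f t) <= n%:R.
Proof.
move=> fd d0; elim=> [|n IH] s t Js Jt st.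
  move: st; rewrite mul0r normr_le0 subr_eq0 => /eqP ->.
  by rewrite subrr nm0.
pose q : R := n%:R / n.+1%:R; pose p := s + (t - s) * q.
have nS : 0 < n.+1%:R :> R by rewrite ltr0n.
have q01 : 0 <= q <= 1.
  by apply/andP; split; [rewrite divr_ge0|rewrite ler_pdivrMr// mul1r ler_nat].
have Jp : J p.
  case/andP: q01 => q0 q1; have [le_st|le_ts] := leP s t.
    by apply: (admissible_up Js); rewrite lerDl mulr_ge0// subr_ge0.
  apply: (admissible_up Jt); rewrite -subr_ge0.
  have -> : p - t = (s - t) * (1 - q) by rewrite /p; ring.
  by rewrite mulr_ge0// subr_ge0// ltW.
have sp : `|s - p| <= n%:R * (d / 2).
  have -> : s - p = (s - t) * q by rewrite /p; ring.
  rewrite normrM (ger0_norm (proj1 (andP q01))) /q [leLHS]mulrA ler_pdivrMr//.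
  by rewrite mulrC -mulrA ler_wpM2l// [leRHS]mulrC.
have pt : `|p - t| < d.
  have -> : p - t = (s - t) / n.+1%:R.
    by rewrite /p /q; field; rewrite addrC natr1 gt_eqF.
  rewrite normrM normfV (gtr0_norm nS) ltr_pdivrMr// (le_lt_trans st)//.
  by rewrite mulrC ltr_pM2r// ltr_pdivrMr// ltr_pMr// ltr1n.
have := nm_trans (ext f s) (ext f p) (ext f t).
by have := IH _ _ Js Jp sp; have := fd _ _ Jp Jt pt; rewrite -natr1; lra.
Qed.

Lemma unif_continuous_growth f : unif_continuous f ->
  exists2 C : R, 0 <= C & forall t, J t -> nm (ext f t) <= C * (1 + `|t|).
Proof.
move=> /unif_continuous_nmP/(_ 1 ltr01)[d d0 fd].
have [t0 Jt0] := admissible_nonempty.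
have chain := unif_continuous_chain fd d0.
have d2 : 0 < d / 2 by rewrite divr_gt0.
pose K := (d / 2)^-1; have K0 : 0 < K by rewrite invr_gt0.
exists (nm (ext f t0) + 1 + `|t0| * K + K).
  by rewrite !addr_ge0 ?nm_ge0 ?mulr_ge0 ?(ltW K0).
move=> t Jt; pose n := (Num.truncn (`|t - t0| * K)).+1.
have := chain n t t0 Jt Jt0; rewrite -ler_pdivrMr// => /(_ (ltW (truncnS_gt _))).
have nle : n%:R <= `|t - t0| * K + 1 :> R.
  by rewrite -natr1 lerD2r truncn_le mulr_ge0// ltW.
have := nm_dist (ext f t) (ext f t0).
have tt : `|t - t0| * K <= (`|t| + `|t0|) * K by rewrite ler_wpM2r ?ler_normB// ltW.
have := nm_ge0 (ext f t0); have := normr_ge0 t; have := normr_ge0 t0.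
move: K0 nle tt; set a := nm _; set b := nm (ext f t); set c := `|t|; set e := `|t0|.
move=> K0 nle tt e0 c0 a0 h1 h2.
have : 0 <= a * c + c + e * K * c by rewrite !addr_ge0 ?mulr_ge0// ltW.
by nra.
Qed.

(** On a bounded part f is bounded by its linear growth, so that
    gamma f inherits uniform continuity from gamma and f. *)
Lemma loc_unif_cont_mul gamma f : unif_continuous f -> loc_lipschitz gamma ->
  (forall t, normc (gamma t) = 1) -> loc_unif_cont (fun t => gamma t *: ext f t).
Proof.
move=> uf lg g1 T e e0; have [C C0 fC] := unif_continuous_growth uf.
have [L L0 gL] := lg T.
have [T0|T0] := ltP T 0.
  by exists 1 => // s t _ _ sT; have := le_lt_trans sT T0; rewrite ltNge normr_ge0.
have e2 : 0 < e / 2 by rewrite divr_gt0.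
have [d d0 fd] := (unif_continuous_nmP _).1 uf _ e2.
pose K := L * (C * (1 + T)) + 1.
have K0 : 0 < K by rewrite ltr_wpDl// !mulr_ge0// addr_ge0.
exists (Num.min d (e / 2 / K)); first by rewrite lt_min d0 divr_gt0.
move=> s t Js Jt sT tT; rewrite lt_min ltr_pdivlMr// => /andP[std stK].
have -> : gamma s *: ext f s - gamma t *: ext f t =
    (gamma s - gamma t) *: ext f s + gamma t *: (ext f s - ext f t).
  by rewrite scalerBl scalerBr addrA subrK.
rewrite (le_lt_trans (nmD _ _))// [e]splitr ltr_leD//; last first.
  by rewrite nmZ g1 mul1r ltW// fd.
rewrite nmZ (le_lt_trans _ stK)// mulrC.
have fs : nm (ext f s) <= C * (1 + T).
  by rewrite (le_trans (fC _ Js))// ler_wpM2l// lerD2l.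
rewrite (@le_trans _ _ (C * (1 + T) * (L * `|s - t|)))//.
  by rewrite ler_pM ?nm_ge0// ?gL// normc_ge0.
rewrite /K; set a := C * (1 + T); have := normr_ge0 (s - t); set b := `|s - t|.
by nra.
Qed.

End local_uniform_continuity.

(** * Integrals of an oscillating factor times a slowly varying function *)

Section oscillatory_means.
Context {R : realType} {X : completeNormedModType R[i]}.
Implicit Types (u v F : R -> X) (a b l omega r h t A e eta M : R) (x : X).

Lemma small_step (K e : R) : 0 < e -> exists n0, forall n, (n0 < n)%N -> K / n%:R < e.
Proof.
move=> e0; exists (Num.truncn (K / e)) => n n0n.
have nR : 0 < n%:R :> R by rewrite ltr0n (leq_ltn_trans _ n0n).
rewrite ltr_pdivrMr// mulrC -ltr_pdivrMr//.
by rewrite (lt_le_trans (truncnS_gt _))// ler_nat.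
Qed.

Lemma unif_cont_modulus a b u e : unif_cont_on a b u -> 0 < e ->
  exists n0, forall n, (n0 < n)%N -> forall s t, a <= s <= b -> a <= t <= b ->
    `|s - t| <= (b - a) / n%:R -> nm (u s - u t) <= e.
Proof.
move=> uc /uc[d d0 ud]; have [n0 hn] := small_step (b - a) d0.
by exists n0 => n /hn nd s t sab tab st; apply/ltW/ud => //; exact: le_lt_trans nd.
Qed.

Lemma bochner_riemann0 h u n e : 0 < h -> (0 < n)%N -> unif_cont_on 0 h u ->
  (forall s t, 0 <= s <= h -> 0 <= t <= h -> `|s - t| <= h / n%:R ->
     nm (u s - u t) <= e) ->
  nm (bochner_integral 0 h u -
      \sum_(i < n) (h / n%:R)%:C *: u (h / n%:R * i%:R)) <= e * h.
Proof.
move=> h0 n0 uc ue; have := @bochner_riemann _ _ 0 h u n e h0 n0 uc.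
by rewrite subr0; under eq_bigr do rewrite add0r; apply.
Qed.

(** Norm estimate for a difference of integrals, obtained by comparing Riemann
    sums on a common subdivision. *)
Lemma bochner_integral_dist h u v e : 0 < h -> unif_cont_on 0 h u ->
  unif_cont_on 0 h v -> (forall s, 0 <= s <= h -> nm (u s - v s) <= e) ->
  nm (bochner_integral 0 h u - bochner_integral 0 h v) <= e * h.
Proof.
move=> h0 uc vc uv; apply/ler_addgt0Pr => z z0.
have z1 : 0 < z / (2 * h) by rewrite divr_gt0// mulr_gt0.
have [n1 un] := unif_cont_modulus uc z1; have [n2 vn] := unif_cont_modulus vc z1.
pose n := (maxn n1 n2).+1.
have nR : n%:R != 0 :> R by rewrite pnatr_eq0.
have {}un := un n (leq_ltn_trans (leq_maxl _ _) (ltnSn _)).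
have {}vn := vn n (leq_ltn_trans (leq_maxr _ _) (ltnSn _)).
rewrite subr0 in un vn.
have Bu := bochner_riemann0 h0 (ltn0Sn _) uc un.
have Bv := bochner_riemann0 h0 (ltn0Sn _) vc vn.
have zE : z / (2 * h) * h = z / 2 by field; rewrite gt_eqF.
rewrite zE in Bu Bv; move: Bu Bv.
set Su := \sum_(i < n) _; set Sv := \sum_(i < n) _ => Bu Bv.
have : nm (Su - Sv) <= e * h.
  rewrite /Su /Sv -sumrB (le_trans (nm_sum _ _ _))//.
  apply: (@le_trans _ _ (\sum_(i < n) h / n%:R * e)).
    have d0 : 0 <= h / n%:R by rewrite divr_ge0// ltW.
    apply: ler_sum => i _; rewrite -scalerBr nmZr ger0_norm// ler_wpM2l// uv//.
    rewrite mulr_ge0//= mulrAC ler_pdivrMr ?ltr0n// ler_wpM2l ?(ltW h0)//.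
    by rewrite ler_nat ltnW.
  rewrite sumr_const card_ord -mulr_natl le_eqVlt; apply/orP; left; apply/eqP.
  by field.
have := nm_trans (bochner_integral 0 h u) Su (bochner_integral 0 h v).
have := nm_trans Su Sv (bochner_integral 0 h v).
by rewrite [nm (Sv - _)]nmC; move: Bu Bv; lra.
Qed.

Lemma normc_g omega r t : normc (g omega r t) = 1.
Proof. by rewrite /g /= cos2Dsin2 sqrtr1. Qed.

Lemma Re_g omega r t : complex.Re (g omega r t) = phase omega r 0 t.
Proof. by rewrite /phase addr0. Qed.

Lemma Im_g omega r t : complex.Im (g omega r t) = phase omega r (- (pi / 2)) t.
Proof. by rewrite /phase cosBpihalf. Qed.

Lemma g_lipschitz omega r : 1 <= r -> loc_lipschitz (g omega r).
Proof.
move=> r1 T; exists (2 * (`|omega| * (r * `|T| `^ (r - 1)))).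
  by rewrite !mulr_ge0 ?powR_ge0// (le_trans _ r1).
move=> s t sT tT.
have sT' := le_trans sT (ler_norm T); have tT' := le_trans tT (ler_norm T).
rewrite (le_trans (normc_le_ReIm _))// -mulrA mulr_natl mulr2n.
have -> : complex.Re (g omega r s - g omega r t) =
  phase omega r 0 s - phase omega r 0 t by rewrite -!Re_g.
have -> : complex.Im (g omega r s - g omega r t) =
  phase omega r (- (pi / 2)) s - phase omega r (- (pi / 2)) t by rewrite -!Im_g.
by rewrite lerD// phase_lipschitz.
Qed.

(** On one block the second factor is the constant x, which leaves a Riemann
    sum of g itself; its real and imaginary parts are sums of phases. *)
Lemma oscillatory_block omega r A a l n eta x :
  omega != 0 -> 1 < r -> 1 <= A -> 0 <= l -> (0 < n)%N ->
  A <= a \/ a + l <= - A ->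
  (forall theta y z, a <= y <= a + l -> a <= z <= a + l -> `|y - z| <= l / n%:R ->
     `|phase omega r theta y - phase omega r theta z| <= eta) ->
  nm (\sum_(i < n) (l / n%:R)%:C *: (g omega r (a + l / n%:R * i%:R) *: x))
    <= 2 * ((2 + l) * (A `^ (1 - r) / `|omega|) + l * eta) * nm x.
Proof.
move=> om0 r1 A1 l0 n0 aA Geta.
have osc theta := phase_riemann_sum om0 r1 A1 l0 n0 aA (Geta theta).
under eq_bigr do rewrite scalerA.
rewrite -scaler_suml nmZ ler_wpM2r ?nm_ge0//.
rewrite (le_trans (normc_le_ReIm _))// mulr_natl mulr2n.
have ReE : {morph (@complex.Re R) : y z / y + z >-> y + z} by move=> [? ?] [? ?].
have ImE : {morph (@complex.Im R) : y z / y + z >-> y + z} by move=> [? ?] [? ?].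
rewrite (big_morph _ ReE (erefl _)) (big_morph _ ImE (erefl _)) lerD//.
  move: (osc 0); congr (`|_| <= _); apply: eq_bigr => i _.
  by rewrite -Re_g /= mul0r subr0.
move: (osc (- (pi / 2))); congr (`|_| <= _); apply: eq_bigr => i _.
by rewrite -Im_g /= mul0r addr0.
Qed.

(** The subdivision into N m pieces is grouped into N blocks of m pieces. On
    the block starting at a the function F is replaced by F a, which costs
    h e / N; the remaining sum is bounded by oscillatory_block. *)
Lemma oscillatory_riemann_sum omega r h N m t A e eta M F :
  omega != 0 -> 1 < r -> 1 <= A -> 0 < h -> (0 < N)%N -> (0 < m)%N ->
  A <= t \/ t + h <= - A ->
  (forall y z, t <= y <= t + h -> t <= z <= t + h -> `|y - z| <= h / N%:R ->
     nm (F y - F z) <= e) ->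
  (forall y, t <= y <= t + h -> nm (F y) <= M) ->
  (forall theta y z, t <= y <= t + h -> t <= z <= t + h ->
     `|y - z| <= h / (N * m)%:R ->
     `|phase omega r theta y - phase omega r theta z| <= eta) ->
  nm (\sum_(j < N * m) (h / (N * m)%:R)%:C *:
       (g omega r (t + h / (N * m)%:R * j%:R) *: F (t + h / (N * m)%:R * j%:R)))
    <= h * e + N%:R * (2 * ((2 + h) * (A `^ (1 - r) / `|omega|) + h * eta) * M).
Proof.
move=> om0 r1 A1 h0 N0 m0 tA Fe FM Geta.
have NR : 0 < N%:R :> R by rewrite ltr0n.
have mR : 0 < m%:R :> R by rewrite ltr0n.
pose l := h / N%:R; have l0 : 0 < l by rewrite divr_gt0.
have dE : h / (N * m)%:R = l / m%:R by rewrite natrM invfM mulrA.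
have Nl : l * N%:R = h by rewrite /l divfK// gt_eqF.
rewrite dE; set d := l / m%:R; have d0 : 0 < d by rewrite divr_gt0.
have md : d * m%:R = l by rewrite /d divfK// gt_eqF.
pose p (j : nat) := t + d * j%:R.
rewrite -(big_mkord xpredT (fun j => d%:C *: (g omega r (p j) *: F (p j)))).
(* The index j is k m + i, with k the block and i the position in it. *)
rewrite big_nat_mul big_mkord (le_trans (nm_sum _ _ _))//.
pose B := 2 * ((2 + h) * (A `^ (1 - r) / `|omega|) + h * eta) * M.
apply: (@le_trans _ _ (\sum_(k < N) (l * e + B))); last first.
  rewrite sumr_const card_ord -[leLHS]mulr_natr.
  have -> : (l * e + B) * N%:R = l * N%:R * e + N%:R * B by ring.
  by rewrite Nl.
apply: ler_sum => k _.
rewrite -{1}[(k * m)%N]add0n big_addn mulSn addnK big_mkord.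
pose a := t + l * k%:R.
have ta : t <= a by rewrite lerDl mulr_ge0// ltW.
have al : a + l <= t + h.
  rewrite /a -addrA lerD2l -Nl -[X in _ + X]mulr1 -mulrDr natr1.
  by rewrite ler_wpM2l ?(ltW l0)// ler_nat.
have pE (i : nat) : p (i + k * m)%N = a + d * i%:R.
  by rewrite /p /a -md natrD natrM; ring.
have pin (i : 'I_m) : a <= a + d * i%:R <= a + l.
  rewrite lerDl mulr_ge0 ?(ltW d0)//= lerD2l -md.
  by rewrite ler_wpM2l ?(ltW d0)// ler_nat ltnW.
have inth y : a <= y <= a + l -> t <= y <= t + h.
  by move=> /andP[ay yl]; rewrite (le_trans ta ay) (le_trans yl al).
have aal : a <= a <= a + l by rewrite lexx lerDl ltW.
have aA : A <= a \/ a + l <= - A.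
  by case: tA => tA; [left; exact: le_trans ta|right; exact: le_trans tA].
have blk := @oscillatory_block omega r A a l m eta (F a) om0 r1 A1 (ltW l0) m0 aA.
have e0 : 0 <= eta.
  by apply: le_trans (Geta 0 t t _ _ _); rewrite ?normr_ge0// ?lexx ?lerDl
    ?(ltW h0)// subrr normr0 divr_ge0// ltW.
under eq_bigr do rewrite pE -[F (a + _)](subrK (F a)) scalerDr scalerDr.
rewrite big_split/= (le_trans (nmD _ _))// lerD//.
  rewrite (le_trans (nm_sum _ _ _))//.
  apply: (@le_trans _ _ (\sum_(i < m) d * e)).
    apply: ler_sum => i _; rewrite nmZr nmZ normc_g mul1r (gtr0_norm d0).
    rewrite ler_wpM2l ?(ltW d0)// Fe ?inth ?pin//.
    rewrite [a + _]addrC addrK ger0_norm ?mulr_ge0 ?(ltW d0) ?(ltW h0)//.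
    rewrite -[leRHS]/l -[leRHS]md.
    by rewrite ler_wpM2l ?(ltW d0)// ler_nat ltnW.
  by rewrite sumr_const card_ord -[leLHS]mulr_natr mulrAC md.
rewrite (le_trans (blk _))//.
  move=> theta y z yin zin yz; apply: Geta; rewrite ?inth//.
  by rewrite dE.
have lh : l <= h by rewrite -Nl ler_peMr ?(ltW l0)// ler1n.
have K0 : 0 <= A `^ (1 - r) / `|omega| by rewrite divr_ge0 ?powR_ge0.
rewrite /B -[leLHS]mulrA -[leRHS]mulrA ler_wpM2l// ler_pM ?nm_ge0 ?FM ?inth//.
  by rewrite addr_ge0 ?(mulr_ge0 _ K0) ?(mulr_ge0 (ltW l0))// addr_ge0// ltW.
by rewrite lerD ?ler_wpM2r// lerD2l.
Qed.

(** The number N of blocks stays fixed, while the number m of pieces per block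
    is arbitrarily large, which removes the discretisation error eta. *)
Lemma oscillatory_integral omega r h N t A e M F :
  omega != 0 -> 1 < r -> 1 <= A -> 0 < h -> (0 < N)%N ->
  A <= t \/ t + h <= - A ->
  (forall y z, t <= y <= t + h -> t <= z <= t + h -> `|y - z| <= h / N%:R ->
     nm (F y - F z) <= e) ->
  (forall y, t <= y <= t + h -> nm (F y) <= M) ->
  unif_cont_on 0 h (fun s => g omega r (t + s) *: F (t + s)) ->
  nm (bochner_integral 0 h (fun s => g omega r (t + s) *: F (t + s)))
    <= h * e + N%:R * (2 * ((2 + h) * (A `^ (1 - r) / `|omega|)) * M).
Proof.
move=> om0 r1 A1 h0 N0 tA Fe FM uc; apply/ler_addgt0Pr => z z0.
have M0 : 0 <= M by apply: le_trans (FM t _); rewrite ?nm_ge0// lexx lerDl ltW.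
(* D eta bounds the sum of both errors that are linear in eta. *)
pose D := h + N%:R * (2 * h * M) + 1.
have D0 : 0 < D by rewrite ltr_wpDl// addr_ge0 ?mulr_ge0 ?ler0n ?(ltW h0).
have eta0 : 0 < z / D by rewrite divr_gt0.
pose eta : R := z / D.
pose L : R := `|omega| * (r * (`|t| + h) `^ (r - 1)).
have [n1 un] := unif_cont_modulus uc eta0.
have [n2 ln] := small_step (L * h) eta0.
pose m := (maxn n1 n2).+1.
have mNm : (m <= N * m)%N by rewrite leq_pmull.
have Nm0 : (0 < N * m)%N by rewrite muln_gt0 N0.
have {}un := un (N * m)%N (leq_ltn_trans (leq_maxl n1 n2) mNm).
have {}ln := ln (N * m)%N (leq_ltn_trans (leq_maxr n1 n2) mNm).
rewrite subr0 in un.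
have Geta theta y y' : t <= y <= t + h -> t <= y' <= t + h ->
    `|y - y'| <= h / (N * m)%:R ->
    `|phase omega r theta y - phase omega r theta y'| <= eta.
  have bnd (q : R) : t <= q <= t + h -> `|q| <= `|t| + h.
    move=> /andP[tq qh]; rewrite ler_norml; have := ler_norm t.
    have := ler_norm (- t); rewrite normrN => ? ?; apply/andP; split; lra.
  move=> yin yin' yy; have lip := phase_lipschitz omega theta (ltW r1) (bnd _ yin) (bnd _ yin').
  rewrite (le_trans lip)//.
  rewrite (le_trans _ (ltW ln))// -/L -[leRHS]mulrA ler_wpM2l//.
  by rewrite /L !mulr_ge0 ?powR_ge0// (le_trans _ (ltW r1)).
have S := oscillatory_riemann_sum om0 r1 A1 h0 N0 (ltn0Sn _ : (0 < m)%N) tA Fe FM Geta.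
have I := bochner_riemann0 h0 Nm0 uc un.
have := nm_dist (bochner_integral 0 h (fun s => g omega r (t + s) *: F (t + s)))
  (\sum_(i < N * m) (h / (N * m)%:R)%:C *:
     (g omega r (t + h / (N * m)%:R * i%:R) *: F (t + h / (N * m)%:R * i%:R))).
move=> /le_trans; apply; apply: (le_trans (lerD I S)).
have zE : eta * D = z by rewrite /eta divfK// gt_eqF.
rewrite -/eta -[X in _ <= _ + X]zE /D; have : 0 < eta by [].
by set K := A `^ (1 - r) / _; lra.
Qed.

End oscillatory_means.

(** * Means of functions on J *)

Section means.
Context {R : realType} {X : completeNormedModType R[i]} {J : set R}.
Implicit Types (f : J -> X) (omega r h a b t : R).

Local Notation ext := ('valL_ (0 : X)).

Hypothesis admJ : admissible_domain J.

Lemma loc_unif_cont_itv f a b : loc_unif_cont (J := J) (ext f) ->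
  `[a, b] `<=` J -> unif_cont_on a b (ext f).
Proof.
move=> lf abJ e e0; have [d d0 fd] := lf (`|a| + `|b|) e e0; exists d => //.
have bnd (q : R) : a <= q <= b -> `|q| <= `|a| + `|b|.
  move=> /andP[aq qb]; rewrite ler_norml; have := ler_norm b.
  have := ler_norm (- a); rewrite normrN; have := normr_ge0 a; have := normr_ge0 b.
  by move=> *; apply/andP; split; lra.
by move=> s t sab tab; apply: fd; rewrite ?bnd//; apply: abJ; rewrite /= in_itv.
Qed.

Lemma loc_unif_cont_shift f h t : loc_unif_cont (J := J) (ext f) -> J t ->
  unif_cont_on 0 h (fun s => ext f (t + s)).
Proof.
move=> lf Jt e e0.
have [] := @loc_unif_cont_itv f t (t + h) lf _ e e0.
  by move=> s /=; rewrite in_itv/= => /andP[ts _]; exact: admissible_up Jt ts.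
move=> d d0 fd; exists d => // s s' /andP[s0 sh] /andP[s'0 s'h] ss'.
apply: fd; rewrite ?lerDl ?lerD2l ?s0 ?s'0//.
by rewrite opprD addrACA subrr add0r.
Qed.

Lemma valL_mean f h t : J t ->
  ext (mean h f) t = (h^-1)%:C *: bochner_integral 0 h (fun s => ext f (t + s)).
Proof. by move=> Jt; rewrite -[t]/(\val (SigSub (mem_set Jt) : J)) valLE. Qed.

Lemma loc_unif_cont_L1loc f : loc_unif_cont (J := J) (ext f) -> L1loc J X f.
Proof.
move=> lf a b ab abJ; exists (fun n => grid_step a b n.+1 (ext f)).
by apply: grid_step_approx => //; exact: loc_unif_cont_itv.
Qed.

Lemma mean_loc_unif_cont f h : 0 < h -> loc_unif_cont (J := J) (ext f) ->
  loc_unif_cont (J := J) (ext (mean h f)).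
Proof.
move=> h0 lf T e e0; have e2 : 0 < e / 2 by rewrite divr_gt0.
have [d d0 fd] := lf (T + h) _ e2; exists d => // s t Js Jt sT tT st.
rewrite !valL_mean// -scalerBr nmZr ger0_norm ?invr_ge0 ?(ltW h0)//.
rewrite mulrC ltr_pdivrMr// (@le_lt_trans _ _ (e / 2 * h))//; last first.
  by rewrite ltr_pM2r// ltr_pdivrMr// ltr_pMr// ltr1n.
apply: bochner_integral_dist => //; [exact: loc_unif_cont_shift..|].
move=> x /andP[x0 xh]; have bnd (q : R) : `|q| <= T -> `|q + x| <= T + h.
  by move=> qT; rewrite (le_trans (ler_normD _ _))// lerD// ger0_norm.
apply/ltW/fd; rewrite ?bnd//.
- by apply: (admissible_up admJ Js); rewrite lerDl.
- by apply: (admissible_up admJ Jt); rewrite lerDl.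
- by rewrite opprD addrACA subrr addr0.
Qed.

Lemma powRN_small (p e : R) : 0 < p -> 0 < e ->
  exists2 A0 : R, 1 <= A0 & forall A, A0 <= A -> A `^ (- p) <= e.
Proof.
move=> p0 e0; exists (Num.max 1 (e^-1 `^ p^-1)); first by rewrite le_max lexx.
move=> A; rewrite ge_max => /andP[A1 eA].
have A0 : 0 < A by exact: lt_le_trans A1.
rewrite powRN -[e]invrK lef_pV2 ?posrE ?powR_gt0 ?invr_gt0//.
have {1}-> : e^-1 = (e^-1 `^ p^-1) `^ p.
  by rewrite -powRrM mulVf ?gt_eqF// powRr1// invr_ge0 ltW.
by rewrite ge0_ler_powR ?nnegrE ?powR_ge0// ltW.
Qed.

(** With A = |t| - h, a lower bound of the modulus on [t, t + h], the function
    f is at most a constant times A there, and the scalar integrals are O(A^(1-r)); since N depends on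
    e only, the decay A^(2-r) wins. *)
Lemma mean_vanishing f omega r h : unif_continuous f -> omega != 0 -> 2 < r ->
  0 < h -> vanishing (J := J) (ext (mean h (fun t : J => g omega r (\val t) *: f t))).
Proof.
move=> uf om0 r2 h0 e e0; have r1 : 1 < r by rewrite (lt_trans _ r2)// ltr1n.
have e2 : 0 < e / 2 by rewrite divr_gt0.
have [d d0 fd] := (unif_continuous_nmP _).1 uf _ e2.
have [C C0 fC] := unif_continuous_growth admJ uf.
have [n0 hn] := small_step h d0.
pose N := n0.+1; have Nd := hn N (ltnSn _).
have o0 : 0 < `|omega| by rewrite normr_gt0.
(* K A^(2-r) bounds the oscillatory part of the integral, and A is taken so
   large that this is at most e h / 4; freezing f costs another e h / 2. *)
pose K := N%:R * (2 * ((2 + h) * `|omega|^-1) * (C * (2 + 2 * h))).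
have K0 : 0 <= K by rewrite !mulr_ge0 ?invr_ge0 ?addr_ge0 ?mulr_ge0// ltW.
have r20 : 0 < r - 2 by rewrite subr_gt0.
have eK : 0 < e * h / 4 / (K + 1) by rewrite !divr_gt0 ?mulr_gt0// ltr_wpDl.
have [A0 A01 hA] := powRN_small r20 eK.
exists (A0 + h) => t Jt At; pose A := `|t| - h.
have A0A : A0 <= A by rewrite lerBrDr.
have A1 : 1 <= A := le_trans A01 A0A.
have Apos : 0 < A by exact: lt_le_trans A1.
have tA : A <= t \/ t + h <= - A.
  have [t0|t0] := leP 0 t; [left|right].
    by rewrite /A ger0_norm// lerBlDr lerDl ltW.
  by rewrite /A ltr0_norm// opprB opprK addrC.
rewrite valL_mean// nmZr ger0_norm ?invr_ge0 ?(ltW h0)// mulrC ltr_pdivrMr//.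
have inJ y : t <= y <= t + h -> J y by move=> /andP[ty _]; exact: admissible_up ty.
rewrite (valL_mul (g omega r)).
have lgf := loc_unif_cont_mul admJ uf (g_lipschitz omega (ltW r1)) (normc_g omega r).
have uc : unif_cont_on 0 h (fun s => g omega r (t + s) *: ext f (t + s)).
  have := @loc_unif_cont_shift (fun t : J => g omega r (\val t) *: f t) h t.
  rewrite (valL_mul (g omega r)); exact.
have Fe y z : t <= y <= t + h -> t <= z <= t + h -> `|y - z| <= h / N%:R ->
    nm (ext f y - ext f z) <= e / 2.
  move=> /inJ Jy /inJ Jz yz; apply/ltW/fd => //; exact: le_lt_trans Nd.
have FM y : t <= y <= t + h -> nm (ext f y) <= C * (2 + 2 * h) * A.
  move=> yth; rewrite (le_trans (fC _ (inJ _ yth)))// -mulrA ler_wpM2l//.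
  have yb : `|y| <= `|t| + h.
    case/andP: yth => ty yh; rewrite ler_norml; have := ler_norm t.
    by have := ler_norm (- t); rewrite normrN => ? ?; apply/andP; split; lra.
  have : h * 1 <= h * A by rewrite ler_wpM2l// ltW.
  by move: yb A1; rewrite /A; set T := `|t|; set Y := `|y|; nra.
have := oscillatory_integral om0 r1 A1 h0 (ltn0Sn n0 : (0 < N)%N) tA Fe FM uc.
move=> /le_lt_trans; apply.
have -> : N%:R * (2 * ((2 + h) * (A `^ (1 - r) / `|omega|)) * (C * (2 + 2 * h) * A)) =
    K * (A * A `^ (1 - r)) by rewrite /K; ring.
have -> : A * A `^ (1 - r) = A `^ (- (r - 2)).
  have -> : - (r - 2) = 1 + (1 - r) by ring.
  by rewrite [RHS]powRD ?(gt_eqF Apos) ?implybT// powRr1// ltW.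
have h4 : 0 < e * h / 4 by rewrite divr_gt0// mulr_gt0.
have : K * A `^ (- (r - 2)) <= e * h / 4.
  rewrite (@le_trans _ _ (K * (e * h / 4 / (K + 1))))//.
    by rewrite ler_wpM2l// hA.
  by rewrite mulrCA ler_piMr ?(ltW h4)// ler_pdivrMr ?ltr_wpDl// mul1r lerDl.
by move: h4; set Q := K * _; lra.
Qed.

Lemma mulset_sub_mean_C0 omega r (A : set (J -> X)) : omega != 0 -> 2 < r ->
  A `<=` UC J X -> mulset (g omega r) A `<=` M (C0 J X).
Proof.
move=> om0 r2 AUC _ [f /AUC + <-]; rewrite /UC/= => uf.
have r1 : 1 <= r by rewrite (le_trans _ (ltW r2))// ler1n.
have lgf : loc_unif_cont (J := J) (ext (fun t : J => g omega r (\val t) *: f t)).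
  rewrite (valL_mul (g omega r)).
  exact (loc_unif_cont_mul admJ uf (g_lipschitz omega r1) (normc_g omega r)).
split; first exact: loc_unif_cont_L1loc.
move=> h h0; apply/(C0P admJ); split; first exact: mean_loc_unif_cont.
exact: mean_vanishing.
Qed.

(** The conjugate of g has modulus 1, so decay at infinity is kept. *)
Lemma conj_g_C0 omega r f : 1 <= r -> C0 J X f ->
  C0 J X (fun t : J => (g omega r (\val t))^* *: f t).
Proof.
move=> r1 C0f; have [+ _ _] := C0f; rewrite /UC/= => uf.
have [lf vf] := (C0P admJ f).1 C0f.
have normcJ' (z : R[i]) : normc z^* = normc z by case: z => a b /=; rewrite sqrrN.
have g1 t : normc (g omega r t)^* = 1 by rewrite normcJ' normc_g.
apply/(C0P admJ); split.
  rewrite (valL_mul (fun t => (g omega r t)^*)).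
  refine (loc_unif_cont_mul admJ uf _ g1) => T.
  have [L L0 gL] := g_lipschitz omega r1 T; exists L => // s t sT tT.
  have -> : (g omega r s)^* - (g omega r t)^* = (g omega r s - g omega r t)^*.
    by rewrite rmorphB.
  by rewrite normcJ' gL.
move=> e /vf[A hA]; exists A => t Jt At.
by rewrite (valL_mul (fun t => (g omega r t)^*)) nmZ g1 mul1r hA.
Qed.

Lemma mean_C0_sub omega r (A : set (J -> X)) : 2 < r -> C0 J X `<=` A ->
  M (C0 J X) `<=` M (mulset (g omega r) A).
Proof.
move=> r2 C0A f [Lf C0f]; split=> // h /C0f C0m.
have r1 : 1 <= r by rewrite (le_trans _ (ltW r2))// ler1n.
exists (fun t : J => (g omega r (\val t))^* *: mean h f t).
  exact/C0A/conj_g_C0.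
apply/funext => t; rewrite scalerA.
have -> : g omega r (\val t) * (g omega r (\val t))^* = 1.
  by rewrite -sqr_normc normr_normc normc_g expr1n.
by rewrite scale1r.
Qed.

End means.

Local Close Scope complex_scope.
Unset Implicit Arguments.
Set Strict Implicit.

Theorem mainTheorem9 (R : realType) (X : completeNormedModType R[i])
    (J : set R) (omega r : R) (A : set (J -> X)) :
  (exists x : X, x != 0) ->
  admissible_domain J ->
  omega != 0 ->
  2 < r ->
  C0 J X `<=` A ->
  A `<=` UC J X ->
  mulset (g omega r) A `<=` M (C0 J X) /\
  M (C0 J X) `<=` M (mulset (g omega r) A).
Proof.
move=> _ admJ om0 r2 C0A AUC; split; first exact: mulset_sub_mean_C0.
exact: mean_C0_sub.
Qed.
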